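(* Let $P=[0,1]^n$ and let the DD algorithm (defined in the context) be initialized with $L^0=[\,]$, $\theta^0=[\,]$, $R^0=I_{n+1}$, $\mu^0=(x_0;x)$. Process the inequalities $x_i\le1$, i.e. $x_0-x_i\ge0$, for $i=1,\dots,k$ during the first $k$ iterations. Then, up to ordering of columns, $R^k=[V^k,\bar R^k]$, where $V^k$ has $2^k$ columns indexed by the subsets of $\{1,\dots,k\}$ and $\bar R^k$ has $n-k$ columns indexed $1,\dots,n-k$, given by $$V^k=\bigl(1;\chi_S;0_{n-k}\bigr)_{S\subseteq\{1,\dots,k\}},\qquad \bar R^k=[e_{k+1},\dots,e_n].$$ Correspondingly partitioning $\mu^k(x_0;x)$ as $[\nu^k(x_0;x);\omega^k(x_0;x)]$, where $\nu^k$ contains the $2^k$ barycentric coordinates of the columns of $V^k$ and $\omega^k$ the $n-k$ barycentric coordinates of the columns of $\bar R^k$, $$\nu^k_S=\frac{\prod_{i\in S}x_i\prod_{i\in\{1,\dots,k\}\setminus S}(x_0-x_i)}{x_0^{k-1}},\qquad \omega^k_i=x_{k+i}\quad(i=1,\dots,n-k).$$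
   Context: Coordinates of $\mathbb R^{n+1}$ are indexed $0,\dots,n$, points are written $(x_0;x)$, and $e_0,\dots,e_n$ are the unit vectors. $\chi_S\in\{0,1\}^k$ is the indicator vector of $S\subseteq\{1,\dots,k\}$. DD algorithm (with no lineality directions). Let $\bar A_{k,:}(x_0;x)\ge0$ be the inequality processed at iteration $k$ (here $x_0-x_k\ge0$). With $R=R^{k-1}$, $\mu=\mu^{k-1}$, set $\beta=\bar A_{k,:}R$, let $N^-,N^0,N^+$ be the sets of column indices $i$ with $\beta_i<0$, $=0$, $>0$, and $N_{\rm tot}=\sum_{i\in N^+}\mu_i\beta_i$. Then $\mu^k=\bigl(\mu_{N^0},(\mu_i+\sum_{j\in N^-}\mu_j\mu_i\beta_j/N_{\rm tot})_{i\in N^+},(\mu_j\mu_i/N_{\rm tot})_{i\in N^+,j\in N^-}\bigr)$ and $R^k=\bigl(R_{:,N^0},R_{:,N^+},(\beta_iR_{:,j}-\beta_jR_{:,i})_{i\in N^+,j\in N^-}\bigr)$, entries of $\mu^k$ corresponding to columns of $R^k$. *)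

(* Defs.v *)
From HB Require Import structures.
From mathcomp Require Import all_boot all_order all_algebra.

Set Implicit Arguments.
Unset Strict Implicit.
Unset Printing Implicit Defensive.

Import Order.TTheory GRing.Theory Num.Theory.
Local Open Scope ring_scope.

(* The columns of R^k are kept together with the corresponding entries of mu^k;
   each such entry is a function of the homogeneous point (x_0; x), so any
   reordering of columns is the same for all points.  There are no lineality
   directions: L^k and theta^k stay empty and are not recorded. *)
Definition dd_entry (R : realFieldType) (n : nat) : Type :=
  ('cV[R]_n.+1 * ('cV[R]_n.+1 -> R))%type.

Section DoubleDescription.

Variables (R : realFieldType) (n : nat).
Implicit Types (a : 'rV[R]_n.+1) (s : seq (dd_entry R n)) (c : dd_entry R n).

Definition dd_beta a c : R := (a *m c.1) 0 0.

Definition dd_neg a s := [seq c <- s | dd_beta a c < 0].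
Definition dd_zero a s := [seq c <- s | dd_beta a c == 0].
Definition dd_pos a s := [seq c <- s | 0 < dd_beta a c].

Definition dd_Ntot a s (x : 'cV[R]_n.+1) : R :=
  \sum_(c <- dd_pos a s) c.2 x * dd_beta a c.

Definition dd_keep a s (ci : dd_entry R n) : dd_entry R n :=
  (ci.1,
   fun x => ci.2 x + \sum_(cj <- dd_neg a s)
                       cj.2 x * ci.2 x * dd_beta a cj / dd_Ntot a s x).

Definition dd_combine a s (ci cj : dd_entry R n) : dd_entry R n :=
  (dd_beta a ci *: cj.1 - dd_beta a cj *: ci.1,
   fun x => cj.2 x * ci.2 x / dd_Ntot a s x).

Definition dd_step s a : seq (dd_entry R n) :=
  dd_zero a s ++ [seq dd_keep a s ci | ci <- dd_pos a s]
    ++ [seq dd_combine a s ci cj | ci <- dd_pos a s, cj <- dd_neg a s].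

(* R^0 = I_{n+1}, mu^0 = (x_0; x) *)
Definition dd_init : seq (dd_entry R n) :=
  [seq (col j 1%:M, fun x : 'cV[R]_n.+1 => x j 0) | j <- enum 'I_n.+1].

Definition dd_run (rows : seq 'rV[R]_n.+1) : seq (dd_entry R n) :=
  foldl dd_step dd_init rows.

(* The row of the inequality x_0 - x_i >= 0, for 1 <= i <= n; beyond n, the
   function inord would return a junk coordinate. *)
Definition cube_row (i : nat) : 'rV[R]_n.+1 :=
  delta_mx 0 0 - delta_mx 0 (inord i).

(* The vector (1; chi_S; 0_{n-k}).  Here, and wherever 'I_k or 'I_(n - k) is
   used, the ordinal i stands for the element i + 1 of {1, ..., k}, resp.
   {1, ..., n - k}. *)
Definition cube_vertex (k : nat) (S : {set 'I_k}) : 'cV[R]_n.+1 :=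
  \col_(j < n.+1)
    if j == 0 then 1
    else if insub (j : nat).-1 is Some i then (i \in S)%:R
    else 0.

End DoubleDescription.

Arguments dd_run {R n} rows.
Arguments cube_row R n i : clear implicits.
Arguments cube_vertex R n {k} S.

(* Main.v *)
Require Import Defs.
From HB Require Import structures.
From mathcomp Require Import all_boot all_order all_algebra.
From mathcomp Require Import ring zify.

Set Implicit Arguments.
Unset Strict Implicit.
Unset Printing Implicit Defensive.

Import Order.TTheory GRing.Theory Num.Theory.
Local Open Scope ring_scope.

(** After k steps the columns are the cone points (1; chi_S; 0) over the
    subsets S of {1, ..., k}, and the rays e_j with k < j.  The inequality
    x_0 - x_{k+1} >= 0 takes the value 1 on each cone point, -1 on e_{k+1} and 0
    on the other rays ([dd_pos_cube], [dd_neg_cube], [dd_zero_cube]).  So the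
    step keeps the far rays and the cone points, and combines each cone point
    of S with e_{k+1} into the cone point of S together with k+1.

    For the barycentric coordinates, let x_0 be nonzero and p_i = x_i / x_0.  The
    claimed weight of S is, formally, x_0 times the probability that independent
    events of probabilities p_1, ..., p_k occur exactly for the indices in S
    ([cube_weight]).  These expressions sum to 1 ([sum_prod_if_powerset]), so N_tot = x_0
    ([dd_Ntot_cube]).  Hence the update multiplies the weight of S by
    1 - p_{k+1} when k+1 is left out, and by p_{k+1} when it is added, which is
    the claimed weight for k+1 ([cube_weightS]).

    The columns are tracked through a duplicate-free sequence of labels, either
    a set of coordinates or a single coordinate of R^(n+1), whose membership is
    known exactly ([dd_run_cube]).  The bijection of the theorem sends a label to
    its position in this sequence. *)

(** * Sums over subsets *)

(** Expansion of a product of binomials over the index set A. *)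
Lemma sum_prod_if_powerset (R : comPzRingType) (I : finType) (A : {set I})
    (F G : I -> R) :
  \sum_(S in powerset A) \prod_(i in A) (if i \in S then F i else G i)
  = \prod_(i in A) (F i + G i).
Proof.
(* Extended by 0 + 1 outside A, the product ranges over the whole type, and
   the terms of its expansion for the sets not contained in A vanish. *)
transitivity
    (\prod_i ((if i \in A then F i else 0) + (if i \in A then G i else 1))).
  rewrite bigA_distr [RHS](bigID (fun S : {set I} => S \subset A)) /=.
  rewrite [X in _ = _ + X]big1 ?addr0; last first.
    move=> S /subsetPn[i iS /negPf iA].
    by rewrite (bigD1 i) //= iS iA mul0r.
  apply: eq_big => [S|S]; rewrite powersetE // => /subsetP sSA.
  rewrite [LHS]big_mkcond; apply: eq_bigr => i _.
  by case: (boolP (i \in A)) => // /negPf iA; case: ifP => // /sSA; rewrite iA.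
rewrite [RHS]big_mkcond; apply: eq_bigr => i _.
by case: ifP => // _; rewrite add0r.
Qed.

Lemma subset_setU1_notin (I : finType) (p : I) (A S : {set I}) :
  p \notin S -> (S \subset p |: A) = (S \subset A).
Proof.
move=> pS; rewrite -subDset.
by have /setDidPl -> : [disjoint S & [set p]] by rewrite disjoint_sym disjoints1.
Qed.

(** * Labels and entries *)

Section CubeRun.

Variables (R : realFieldType) (n : nat).

(** The coordinates 1, ..., k, as a subset of the coordinates 0, ..., n. *)
Definition first_coords (k : nat) : {set 'I_n.+1} :=
  [set j : 'I_n.+1 | (0 < j <= k)%N].

(** [inl S] labels the cone point over the 0/1 vertex chi_S, and [inr j] labels
    the ray e_j.  Coordinates of R^(n+1) are used directly, so that the type does
    not depend on the number of steps. *)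
Definition column_label : Type := ({set 'I_n.+1} + 'I_n.+1)%type.

(** The labels of the columns present after k steps. *)
Definition active_label (k : nat) : pred column_label :=
  fun u => match u with inl T => T \subset first_coords k | inr j => (k < j)%N end.

Lemma active_labelE (k : nat) (u : column_label) :
  (u \in active_label k) = active_label k u.
Proof. by []. Qed.

(** The point (1; chi_S).  The set S is only meant to contain nonzero
    coordinates; coordinate 0 has the value 1 in any case. *)
Definition homog_vertex (S : {set 'I_n.+1}) : 'cV[R]_n.+1 :=
  \col_j (if j == 0 then 1 else (j \in S)%:R).

(** The weight of S after k steps, with one factor x_0 distributed as a
    denominator to each index: x_0 prod_i p_i^[i in S] (1 - p_i)^[i notin S]. *)
Definition cube_weight (k : nat) (S : {set 'I_n.+1}) (x : 'cV[R]_n.+1) : R :=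
  x 0 0 * \prod_(i in first_coords k)
    ((if i \in S then x i 0 else x 0 0 - x i 0) / x 0 0).

(** The entry [c] is the cone point over chi_S with its weight after k steps.  The
    weight is only prescribed when x_0 is nonzero, so [c] is not determined as a
    function by S, unlike [ray_entry]. *)
Definition vertex_entry (k : nat) (S : {set 'I_n.+1}) (c : dd_entry R n) : Prop :=
  c.1 = homog_vertex S
  /\ forall x : 'cV[R]_n.+1, x 0 0 != 0 -> c.2 x = cube_weight k S x.

(** The ray e_j with the coordinate x_j; step j removes this entry, and the
    earlier steps leave it unchanged. *)
Definition ray_entry (j : 'I_n.+1) : dd_entry R n :=
  (delta_mx j 0, fun x : 'cV[R]_n.+1 => x j 0).

(** The entry of a label, given a choice [g] of the entries of the cone points. *)
Definition labelled_entry (g : {set 'I_n.+1} -> dd_entry R n) (u : column_label) :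
    dd_entry R n :=
  match u with inl T => g T | inr j => ray_entry j end.

Lemma dd_beta_cube_row (i : nat) (c : dd_entry R n) :
  dd_beta (cube_row R n i) c = c.1 0 0 - c.1 (inord i) 0.
Proof.
by rewrite /dd_beta /cube_row mulmxBl -!rowE !mxE.
Qed.

Lemma first_coords0 : first_coords 0 = set0.
Proof. by apply/setP=> j; rewrite !inE; apply/negbTE; lia. Qed.

(** The weights sum to x_0, because the factors p_i and 1 - p_i sum to 1. *)
Lemma sum_cube_weight (k : nat) (x : 'cV[R]_n.+1) : x 0 0 != 0 ->
  \sum_(S in powerset (first_coords k)) cube_weight k S x = x 0 0.
Proof.
move=> x0; rewrite -mulr_sumr -[RHS]mulr1; congr (_ * _).
under eq_bigr do under eq_bigr do rewrite (fun_if (fun y => y / x 0 0)).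
by rewrite sum_prod_if_powerset big1 // => i _; field.
Qed.

(** * One step of the algorithm *)

Section Step.

Variables (k : nat) (lt_kn : (k < n)%N).

Let p : 'I_n.+1 := inord k.+1.

Lemma val_next_coord : p = k.+1 :> nat.
Proof. by rewrite inordK // ltnS. Qed.

Lemma first_coordsS : first_coords k.+1 = p |: first_coords k.
Proof.
by apply/setP=> j; rewrite !inE -val_eqE /= val_next_coord; lia.
Qed.

Lemma next_coord_notin : p \notin first_coords k.
Proof. by rewrite inE val_next_coord; lia. Qed.

Lemma next_coord_notin_sub (S : {set 'I_n.+1}) :
  S \subset first_coords k -> p \notin S.
Proof. by move/subsetP=> sS; apply: contra next_coord_notin => /sS. Qed.

Lemma next_coord_neq0 : (p == 0) = false.
Proof. by rewrite -val_eqE /= val_next_coord. Qed.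

(** One more coordinate multiplies the weight by p_{k+1} or 1 - p_{k+1}. *)
Lemma cube_weightS (S T : {set 'I_n.+1}) (x : 'cV[R]_n.+1) :
    {in first_coords k, S =i T} ->
  cube_weight k.+1 S x =
    cube_weight k T x * ((if p \in S then x p 0 else x 0 0 - x p 0) / x 0 0).
Proof.
move=> eqST; rewrite /cube_weight first_coordsS big_setU1 ?next_coord_notin //=.
rewrite -mulrA [X in _ = _ * X]mulrC; congr (_ * (_ * _)).
by apply: eq_bigr => i /eqST ->.
Qed.

(** The entry of the cone point over chi_S after the step: new if S contains the
    coordinate k+1, and updated from the entry of S otherwise. *)
Definition next_entry (s : seq (dd_entry R n)) (g : {set 'I_n.+1} -> dd_entry R n)
    (S : {set 'I_n.+1}) : dd_entry R n :=
  let a := cube_row R n k.+1 in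
  if p \in S then dd_combine a s (g (S :\ p)) (ray_entry p) else dd_keep a s (g S).

Variables (g : {set 'I_n.+1} -> dd_entry R n) (l : seq column_label).
Hypotheses (uniq_l : uniq l) (mem_l : l =i active_label k).
Hypothesis vertex_g : forall S : {set 'I_n.+1},
  S \subset first_coords k -> vertex_entry k S (g S).

Let a := cube_row R n k.+1.
Let h := labelled_entry g.
Let s := map h l.
Let is_vertex (u : column_label) : bool := if u is inl _ then true else false.
Let is_far_ray (u : column_label) : bool := if u is inr j then j != p else false.

Lemma dd_beta_vertex (S : {set 'I_n.+1}) :
  S \subset first_coords k -> dd_beta a (g S) = 1.
Proof.
move=> sS; rewrite dd_beta_cube_row (vertex_g sS).1 !mxE eqxx -/p.
by rewrite next_coord_neq0 (negPf (next_coord_notin_sub sS)) subr0.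
Qed.

Lemma dd_beta_ray (j : 'I_n.+1) : (k < j)%N -> dd_beta a (ray_entry j) = - (j == p)%:R.
Proof.
move=> ltkj; rewrite dd_beta_cube_row !mxE -/p eqxx !andbT [p == j]eq_sym.
by rewrite -[0 == j]val_eqE /= ltn_eqF ?(leq_ltn_trans _ ltkj) // sub0r.
Qed.

(** Only e_{k+1} violates the inequality. *)
Lemma dd_neg_cube : dd_neg a s = [:: ray_entry p].
Proof.
rewrite /dd_neg /s filter_map.
rewrite (@eq_in_filter _ _ (pred1 (inr p : column_label))); last first.
  move=> [S|j]; rewrite mem_l active_labelE /= => act.
    by rewrite dd_beta_vertex // ltr10.
  rewrite dd_beta_ray // oppr_lt0 ltr0n lt0b.
  by rewrite (inj_eq (@inr_inj _ _)).
by rewrite filter_pred1_uniq // mem_l active_labelE /= val_next_coord.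
Qed.

Lemma dd_pos_cube : dd_pos a s = map h (filter is_vertex l).
Proof.
rewrite /dd_pos /s filter_map; congr map; apply: eq_in_filter.
move=> [S|j]; rewrite mem_l active_labelE /= => act.
  by rewrite dd_beta_vertex // ltr01.
by rewrite dd_beta_ray // oppr_gt0 ltrn0.
Qed.

Lemma dd_zero_cube : dd_zero a s = map h (filter is_far_ray l).
Proof.
rewrite /dd_zero /s filter_map; congr map; apply: eq_in_filter.
move=> [S|j]; rewrite mem_l active_labelE /= => act.
  by rewrite dd_beta_vertex // oner_eq0.
by rewrite dd_beta_ray // oppr_eq0 pnatr_eq0 eqb0.
Qed.

(** Each subset of {1, ..., k} occurs exactly once among the labels. *)
Lemma vertex_labels_perm :
  perm_eq (filter is_vertex l) (map inl (enum (powerset (first_coords k)))).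
Proof.
apply: uniq_perm.
- exact: filter_uniq.
- by rewrite map_inj_uniq ?enum_uniq // => S T [].
move=> [S|j]; rewrite mem_filter mem_l active_labelE /=.
  by rewrite (mem_map (@inl_inj _ _)) mem_enum powersetE.
by symmetry; apply/negP => /mapP[].
Qed.

Lemma dd_Ntot_cube (x : 'cV[R]_n.+1) : x 0 0 != 0 -> dd_Ntot a s x = x 0 0.
Proof.
move=> x0; rewrite /dd_Ntot dd_pos_cube big_map (perm_big _ vertex_labels_perm) /=.
rewrite big_map big_enum /= -[RHS](sum_cube_weight k x0).
apply: eq_bigr => S; rewrite powersetE => sS.
by rewrite dd_beta_vertex // mulr1 (vertex_g sS).2.
Qed.

Lemma next_vertex_entry (S : {set 'I_n.+1}) :
  S \subset first_coords k.+1 -> vertex_entry k.+1 S (next_entry s g S).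
Proof.
rewrite first_coordsS => sS; rewrite /next_entry -/a.
have beta_p : dd_beta a (ray_entry p) = -1.
  by rewrite dd_beta_ray ?eqxx // val_next_coord.
case: (boolP (p \in S)) => pS;
  [rewrite -subDset in sS | rewrite subset_setU1_notin // in sS]; split.
- rewrite /= dd_beta_vertex // beta_p scale1r scaleN1r opprK (vertex_g sS).1.
  apply/colP=> j; rewrite !mxE !inE eqxx andbT.
  case: (eqVneq j p) => [->|_]; first by rewrite next_coord_neq0 pS addr0.
  by rewrite add0r.
- move=> x x0; rewrite /= dd_Ntot_cube // (vertex_g sS).2 //.
  rewrite (@cube_weightS _ (S :\ p)) ?pS; first by rewrite mulrA [_ * x p 0]mulrC.
  move=> i ik; rewrite !inE; suff -> : i != p by [].
  by apply: contraTneq ik => ->; exact: next_coord_notin.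
- by rewrite /= (vertex_g sS).1.
move=> x x0; rewrite /= dd_neg_cube big_seq1 dd_Ntot_cube // beta_p (vertex_g sS).2 //.
by rewrite (@cube_weightS _ S) // (negPf pS) /=; field.
Qed.

(** Combining with e_{k+1} adds the coordinate k+1 to the set. *)
Definition next_label (u : column_label) : column_label :=
  match u with inl T => inl (p |: T) | inr j => inr j end.

(** The labels after the step, in the order of the columns. *)
Definition next_labels : seq column_label :=
  filter is_far_ray l ++ filter is_vertex l
    ++ map next_label (filter is_vertex l).

Lemma dd_step_cube :
  dd_step s a = map (labelled_entry (next_entry s g)) next_labels.
Proof.
rewrite /dd_step dd_zero_cube dd_pos_cube dd_neg_cube allpairs1r !map_cat -!map_comp.
congr (_ ++ (_ ++ _)); apply/eq_in_map => -[S|j]; rewrite mem_filter //=.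
  rewrite mem_l => /next_coord_notin_sub /negPf pS.
  by rewrite /next_entry -/p pS.
rewrite mem_l => /next_coord_notin_sub pS.
by rewrite /next_entry -/p setU11 setU1K.
Qed.

Lemma uniq_next_labels : uniq next_labels.
Proof.
rewrite /next_labels !cat_uniq !filter_uniq //=; apply/and3P; split.
- apply/hasPn => -[S|j]; rewrite mem_cat !mem_filter //=.
  by move=> /mapP[[T|i]]; rewrite mem_filter.
- apply/hasPn => u /mapP[[T|i]]; rewrite mem_filter //= => _ ->.
  rewrite mem_filter mem_l; apply/negP => /= /next_coord_notin_sub.
  by rewrite setU11.
rewrite map_inj_in_uniq ?filter_uniq // => -[S|i] [T|j]; rewrite !mem_filter //= !mem_l.
move=> /next_coord_notin_sub pS /next_coord_notin_sub pT [eqST].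
by rewrite -(setU1K pS) eqST setU1K.
Qed.

Lemma mem_next_labels : next_labels =i active_label k.+1.
Proof.
move=> u; rewrite !mem_cat !mem_filter mem_l !active_labelE.
case: u => [S|j] /=; last first.
  case: mapP => [[[T|i]]|_]; rewrite ?mem_filter // orbF -val_eqE /= val_next_coord.
  by lia.
rewrite first_coordsS; apply/orP/idP => [[sS|/mapP[[T|i]]]|sS].
- exact: subset_trans sS (subsetUr _ _).
- by rewrite mem_filter mem_l => /= sT [->]; rewrite setUS.
- by rewrite mem_filter.
case: (boolP (p \in S)) => pS; [right | left]; last first.
  by rewrite -(subset_setU1_notin _ pS).
apply/mapP; exists (inl (S :\ p)); last by rewrite /= setD1K.
by rewrite mem_filter mem_l /= active_labelE /= subDset.
Qed.

End Step.

(** * The invariant and the final indexing *)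

(** After k steps the columns are labelled bijectively by the active labels. *)
Lemma dd_run_cube (k : nat) : (k <= n)%N ->
  exists (g : {set 'I_n.+1} -> dd_entry R n) (l : seq column_label),
  [/\ dd_run [seq cube_row R n i | i <- iota 1 k] = map (labelled_entry g) l,
      uniq l, l =i active_label k
    & forall S : {set 'I_n.+1}, S \subset first_coords k -> vertex_entry k S (g S)].
Proof.
elim: k => [_|k IHk ltkn]; last first.
  have [g [l [def_s uniq_l mem_l vertex_g]]] := IHk (ltnW ltkn).
  rewrite -[in iota _ _](addn1 k) iotaD map_cat /dd_run foldl_cat.
  rewrite -/(dd_run _) def_s /= add1n.
  exists (next_entry k (map (labelled_entry g) l) g), (next_labels k l).
  split; [exact: dd_step_cube | exact: uniq_next_labels | exact: mem_next_labels |].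
  exact: next_vertex_entry.
(* Initially e_0 is the cone point of the empty set, and x_0 its weight. *)
exists (fun=> ray_entry 0).
exists [seq if j == 0 then inl set0 else inr j | j : 'I_n.+1 <- enum 'I_n.+1]; split.
- rewrite /dd_run /= /dd_init -[RHS]map_comp; apply: eq_map => j /=.
  have -> : labelled_entry (fun=> ray_entry 0) (if j == 0 then inl set0 else inr j)
      = ray_entry j by case: eqP => [->|].
  by congr pair; apply/colP => i; rewrite !mxE eqxx andbT.
- rewrite map_inj_uniq ?enum_uniq // => i j.
  by case: eqP => [->|_]; case: eqP => [->|_] // [].
- move=> u; apply/mapP/idP => [[j _ ->]|].
    by rewrite active_labelE; case: eqVneq => [_|j0] /=; rewrite ?sub0set // lt0n.
  rewrite active_labelE; case: u => [S|j] /=.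
    rewrite first_coords0 subset0 => /eqP->.
    by exists 0; rewrite ?mem_enum.
  rewrite lt0n => j0; exists j; rewrite ?mem_enum // ifN //.
move=> S; rewrite first_coords0 subset0 => /eqP->; split=> [|x x0] /=.
  by apply/colP => j; rewrite !mxE inE andbT; case: eqP.
by rewrite /cube_weight first_coords0 big_set0 mulr1.
Qed.

End CubeRun.

Section FinalLabels.

Variables (n k : nat) (le_kn : (k <= n)%N).

(** The ordinal i < k stands for the coordinate i + 1. *)
Definition coord_of (i : 'I_k) : 'I_n.+1 := inord i.+1.

Lemma val_coord_of (i : 'I_k) : coord_of i = i.+1 :> nat.
Proof. by rewrite inordK // ltnS (leq_trans (ltn_ord i)). Qed.

Lemma coord_of_inj : injective coord_of.
Proof.
move=> i j /(congr1 (@nat_of_ord _)); rewrite !val_coord_of => -[].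
exact: val_inj.
Qed.

Lemma imset_coord_of : [set coord_of i | i : 'I_k] = first_coords n k.
Proof.
apply/setP=> j; rewrite inE; apply/imsetP/idP => [[i _ ->]|jk].
  by rewrite val_coord_of /=.
have lt_jk : (j.-1 < k)%N by lia.
by exists (Ordinal lt_jk) => //; apply/val_inj; rewrite /= val_coord_of /=; lia.
Qed.

(** From the indices of the columns of V^k and of the ray part to labels. *)
Definition label_of (u : {set 'I_k} + 'I_(n - k)) : column_label n :=
  match u with
  | inl T => inl [set coord_of i | i in T]
  | inr i => inr (inord (k + i.+1))
  end.

Lemma val_ray_coord (i : 'I_(n - k)) :
  (inord (k + i.+1) : 'I_n.+1) = (k + i.+1)%N :> nat.
Proof. by rewrite inordK //; have := ltn_ord i; lia. Qed.

Lemma label_of_inj : injective label_of.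
Proof.
move=> [S|i] [T|j] //= [].
  by move/(imset_inj coord_of_inj) ->.
move/(congr1 (@nat_of_ord _)); rewrite !val_ray_coord => eqij.
by congr inr; apply: val_inj => /=; lia.
Qed.

Lemma codom_label_of : codom label_of =i active_label (n := n) k.
Proof.
move=> u; apply/codomP/idP => [[v ->]|]; rewrite active_labelE.
  case: v => [S|i] /=; last by rewrite val_ray_coord; lia.
  by rewrite -imset_coord_of; apply/imsetS/subsetP.
case: u => [S|j] /= act.
  exists (inl (coord_of @^-1: S)); congr inl => /=.
  apply/setP=> j; apply/idP/imsetP => [jS|[i]]; last by rewrite inE => ? ->.
  have := subsetP act _ jS; rewrite -imset_coord_of => /imsetP[i _ def_j].
  by exists i; rewrite // inE -def_j.
have lt_j : (j - k.+1 < n - k)%N by have := ltn_ord j; lia.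
exists (inr (Ordinal lt_j)); congr inr; apply: ord_inj.
by rewrite val_ray_coord /=; lia.
Qed.

Lemma homog_vertexE (R : realFieldType) (S : {set 'I_k}) :
  homog_vertex R [set coord_of i | i in S] = cube_vertex R n S.
Proof.
apply/colP=> j; rewrite !mxE; case: (eqVneq j 0) => // j0.
have j_gt0 : (0 < j)%N by rewrite lt0n -val_eqE in j0 *.
case: insubP => [i lt_j def_i|nlt_j].
  have -> : j = coord_of i by apply: val_inj; rewrite /= val_coord_of def_i; lia.
  by rewrite mem_imset //; exact: coord_of_inj.
case: imsetP => // -[i _ def_j]; case/negP: nlt_j.
by rewrite def_j val_coord_of /=.
Qed.

Lemma cube_weightE (R : realFieldType) (S : {set 'I_k}) (x : 'cV[R]_n.+1) :
    x 0 0 != 0 ->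
  cube_weight k [set coord_of i | i in S] x =
    (\prod_(i in S) x (inord i.+1) 0)
    * (\prod_(i in ~: S) (x 0 0 - x (inord i.+1) 0)) / x 0 0 ^ (k%:Z - 1).
Proof.
move=> x0; rewrite /cube_weight -imset_coord_of big_imset /=; last first.
  by move=> i j _ _; exact: coord_of_inj.
rewrite prodf_div prodr_const card_ord expfzDr // -exprnP.
rewrite (bigID (fun i => i \in S)) /=; set Q := (X in _ * (X / _)).
have -> : Q = (\prod_(i in S) x (inord i.+1) 0)
    * (\prod_(i in ~: S) (x 0 0 - x (inord i.+1) 0)).
  congr (_ * _); apply: eq_big => i; rewrite ?inE // mem_imset; try exact: coord_of_inj.
    by move->.
  by move/negPf ->.
by rewrite exprN1 invfM invrK mulrA mulrC; ring.
Qed.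

End FinalLabels.

Theorem proposition3 (R : realFieldType) (n k : nat) (le_kn : (k <= n)%N) :
  let s := dd_run [seq cube_row R n i | i <- iota 1 k] in
  exists f : {set 'I_k} + 'I_(n - k) -> 'I_(size s),
  [/\ bijective f,
      forall S : {set 'I_k},
        (tnth (in_tuple s) (f (inl S))).1 = cube_vertex R n S,
      forall i : 'I_(n - k),
        (tnth (in_tuple s) (f (inr i))).1 = delta_mx (inord (k + i.+1)) 0,
      forall (x : 'cV[R]_n.+1) (S : {set 'I_k}), x 0 0 != 0 ->
        (tnth (in_tuple s) (f (inl S))).2 x =
          (\prod_(i in S) x (inord i.+1) 0)
          * (\prod_(i in ~: S) (x 0 0 - x (inord i.+1) 0))
          / x 0 0 ^ (k%:Z - 1)
    & forall (x : 'cV[R]_n.+1) (i : 'I_(n - k)),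
        (tnth (in_tuple s) (f (inr i))).2 x = x (inord (k + i.+1)) 0].
Proof.
move=> s; have [g [l [def_s uniq_l mem_l vertex_g]]] := dd_run_cube R le_kn.
have size_s : size s = size l by rewrite /s def_s size_map.
have label_in (u : {set 'I_k} + 'I_(n - k)) : label_of u \in l.
  by rewrite mem_l -(codom_label_of le_kn) codom_f.
have index_lt (u : {set 'I_k} + 'I_(n - k)) : (index (label_of u) l < size s)%N.
  by rewrite size_s index_mem.
pose f u := Ordinal (index_lt u).
have tnth_f u : tnth (in_tuple s) (f u) = labelled_entry g (label_of u).
  rewrite (tnth_nth (ray_entry R 0)) /= /s def_s (nth_map (inr 0)) ?index_mem //.
  by rewrite nth_index.
have vertex_f (S : {set 'I_k}) :
    vertex_entry k [set coord_of n i | i in S] (g [set coord_of n i | i in S]).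
  by apply: vertex_g; rewrite -(imset_coord_of le_kn); apply/imsetS/subsetP.
exists f; split.
(* The sequence of labels has no duplicates and consists of values of
   [label_of], so it is not longer than the number of indices. *)
- apply: inj_card_bij => [u v [eq_uv]|].
    by apply: (label_of_inj le_kn); apply: (index_inj (inr 0)) eq_uv.
  rewrite card_ord size_s -(size_codom (@label_of n k)).
  by apply: uniq_leq_size => // u; rewrite mem_l (codom_label_of le_kn).
- by move=> S; rewrite tnth_f (vertex_f S).1 (homog_vertexE le_kn).
- by move=> i; rewrite tnth_f.
- by move=> x S x0; rewrite tnth_f (vertex_f S).2 // (cube_weightE le_kn).
by move=> x i; rewrite tnth_f.
Qed.
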